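(* Let $(u_h,\bar u_h,p_h,\bar p_h)\in V_h\times\bar V_h\times Q_h\times\bar Q_h$ satisfy the semi-discrete problem (M1)--(M4) given in the context. Then $$\frac{d}{dt}\int_Ku_h\,dx=\int_Kf\,dx-\int_{\partial K}\hat\sigma_h n\,ds\qquad\forall K\in\mathcal T.$$ Furthermore, if $\Gamma_D=\emptyset$, then $$\frac{d}{dt}\int_\Omega u_h\,dx=\int_\Omega f\,dx-\int_{\partial\Omega}(1-\lambda)(\bar u_h\cdot n)\,\bar u_h\,ds-\int_{\partial\Omega}h\,ds.$$
   Context: Setting. $\Omega\subset\mathbb R^d$ is a polygonal ($d=2$) or polyhedral ($d=3$) domain with outward unit normal $n$; $I=(0,t_N]$ is the time interval; $\partial\Omega=\Gamma_D\cup\Gamma_N$ with $\Gamma_D\cap\Gamma_N=\emptyset$; $\nu>0$ is the kinematic viscosity; $f$ is a forcing term with $f\in[L^2(\Omega)]^d$ and $h\in[L^2(\Gamma_N)]^d$ is boundary data (at each time). $\mathcal T=\{K\}$ is a triangulation of $\Omega$ into non-overlapping simplices $K$; $n$ also denotes the outward unit normal on $\partial K$; $h_K$ is the size (diameter) of $K$. Two adjacent cells $K^+,K^-$ share an interior facet $F=\partial K^+\cap\partial K^-$; a facet of $\partial K$ lying on $\partial\Omega$ is a boundary facet. $\mathcal F$ is the set of all (interior and boundary) facets. Spaces. $P_l(D)$ denotes polynomials of degree (at most) $l$ on $D$, and $k\ge2$ is an integer. $V_h=\{v_h\in[L^2(\mathcal T)]^d: v_h|_K\in[P_k(K)]^d\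 \forall K\in\mathcal T\}$; $\bar V_h=\{\bar v_h\in[L^2(\mathcal F)]^d:\bar v_h|_F\in[P_k(F)]^d\ \forall F\in\mathcal F,\ \bar v_h=0\text{ on }\Gamma_D\}$; $Q_h=\{q_h\in L^2(\mathcal T): q_h|_K\in P_{k-1}(K)\ \forall K\in\mathcal T\}$; $\bar Q_h=\{\bar q_h\in L^2(\mathcal F):\bar q_h|_F\in P_k(F)\ \forall F\in\mathcal F\}$. Functions in $\bar V_h,\bar Q_h$ live only on facets and are single-valued there; functions in $V_h,Q_h$ may be discontinuous across facets, and in integrals over $\partial K$ their traces from inside $K$ are used. Fluxes. $(a\otimes b)_{ij}=a_ib_j$, $(\nabla u)_{ij}=\partial u_i/\partial x_j$, $\mathbb I$ is the identity tensor. $\sigma_h=\sigma_{a,h}+\sigma_{d,h}$ with $\sigma_{a,h}=u_h\otimes u_h$ and $\sigma_{d,h}=p_h\mathbb I-\nu\nabla u_h$. The numerical flux is $\hat\sigma_h=\hat\sigma_{a,h}+\hat\sigma_{d,h}$ with $\hat\sigma_{a,h}=\sigma_{a,h}+(\bar u_h-u_h)\otimes\lambda u_h$ and $\hat\sigma_{d,h}=\bar p_h\mathbb I-\nu\nabla u_h-\frac{\nu\alpha}{h_K}(\bar u_h-u_h)\otimes n$, where $\lambda=1$ on parts of cell boundaries with $u_h\cdot n<0$, $\lambda=0$ where $u_h\cdot n\ge0$, and $\alpha>0$ is a penalty parameter. Semi-discrete problem: at each time in $I$, find $(u_h,\bar u_h,p_h,\bar p_h)\in V_h\times\bar V_h\times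 Q_h\times\bar Q_h$ such that (M1) $0=\sum_K\int_K u_h\cdot\nabla q_h\,dx-\sum_K\int_{\partial K}u_h\cdot n\,q_h\,ds$ for all $q_h\in Q_h$; (M2) $0=\sum_K\int_{\partial K}u_h\cdot n\,\bar q_h\,ds-\int_{\partial\Omega}\bar u_h\cdot n\,\bar q_h\,ds$ for all $\bar q_h\in\bar Q_h$; (M3) $\int_\Omega f\cdot v_h\,dx=\int_\Omega\partial_tu_h\cdot v_h\,dx-\sum_K\int_K\sigma_h:\nabla v_h\,dx+\sum_K\int_{\partial K}\hat\sigma_h:(v_h\otimes n)\,ds+\sum_K\int_{\partial K}\nu\,((\bar u_h-u_h)\otimes n):\nabla v_h\,ds$ for all $v_h\in V_h$; (M4) $\int_{\Gamma_N}h\cdot\bar v_h\,ds=\sum_K\int_{\partial K}\hat\sigma_h:(\bar v_h\otimes n)\,ds-\int_{\Gamma_N}(1-\lambda)(\bar u_h\cdot n)\,\bar u_h\cdot\bar v_h\,ds$ for all $\bar v_h\in\bar V_h$. The solution is understood to depend on time with $u_h$ differentiable in time. *)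

(* Defs.v *)
From HB Require Import structures.
From mathcomp Require Import all_boot all_order all_algebra.
From mathcomp Require Import -(notations) mpoly.
From mathcomp Require Import all_classical all_reals all_analysis.
From mathcomp Require Import measurable_realfun.

Set Implicit Arguments.
Unset Strict Implicit.
Unset Printing Implicit Defensive.

Import Order.TTheory GRing.Theory Num.Theory numFieldNormedType.Exports.
Local Open Scope classical_set_scope.
Local Open Scope ring_scope.

(* Borel sets of R^n, as the product sigma-algebra. *)
Section RowMeasurable.
Context (R : realType) (n : nat).
Let coord (i : 'I_n) (x : 'rV[R]_n) : R := x 0 i.
Let row_set0 : g_sigma_preimage coord set0.
Proof. exact: sigma_algebra0. Qed.
Let row_setC A : g_sigma_preimage coord A -> g_sigma_preimage coord (~` A).
Proof. exact: sigma_algebraC. Qed.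
Let row_bigcup (F : _^nat) : (forall i, g_sigma_preimage coord (F i)) ->
  g_sigma_preimage coord (\bigcup_i (F i)).
Proof. exact: sigma_algebra_bigcup. Qed.
HB.instance Definition _ := @isMeasurable.Build
  (measure_tuple_display default_measure_display)
  'rV[R]_n (g_sigma_preimage coord) row_set0 row_setC row_bigcup.

Lemma measurable_coord (i : 'I_n) :
  measurable_fun [set: 'rV[R]_n] (fun x => x 0 i).
Proof.
move=> _ Y mY; rewrite setTI; apply: sub_sigma_algebra => /=.
rewrite -bigcup_seq/=.
exists i => //=; first by rewrite mem_index_enum.
exists Y => //; by rewrite setTI.
Qed.

Lemma measurable_fun_row d (T : measurableType d) (f : T -> 'rV[R]_n) :
  (forall i, measurable_fun [set: T] (fun x => f x 0 i)) ->
  measurable_fun [set: T] f.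
Proof.
move=> mf; apply: (@measurability _ _ _ _ _ _ (\big[setU/set0]_(i < n)
  preimage_set_system setT (coord i) measurable)) => //.
move=> _ [C + <-]; rewrite setTI -bigcup_seq/= => -[i _ [Y mY <-]].
by rewrite setTI; have := mf i measurableT Y mY; rewrite setTI.
Qed.
End RowMeasurable.

Definition image_measure d1 d2 (T1 : measurableType d1) (T2 : measurableType d2)
    (R : realType) (mu : {measure set T1 -> \bar R}) (f : T1 -> T2)
    (mf : measurable_fun setT f) : {measure set T2 -> \bar R} :=
  measure_function_pushforward__canonical__measure_function_Measure mu mf.

Section LebesgueRow.
Context (R : realType).

Definition row_cons n (xv : R * 'rV[R]_n) : 'rV[R]_n.+1 :=
  \row_i (if unlift ord0 i is Some j then xv.2 0 j else xv.1).

Definition row_behead n (w : 'rV[R]_n.+1) : 'rV[R]_n :=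
  \row_j w 0 (lift ord0 j).

Lemma measurable_row_cons n : measurable_fun setT (@row_cons n).
Proof.
apply: measurable_fun_row => i; case: (unliftP ord0 i) => [j|] ->.
  rewrite (_ : (fun _ => _) = (fun v : 'rV[R]_n => v 0 j) \o snd).
    by apply: measurableT_comp => //; exact: measurable_coord.
  by apply/funext => -[x v]; rewrite /row_cons mxE liftK.
rewrite (_ : (fun _ => _) = fst) //.
by apply/funext => -[x v]; rewrite /row_cons mxE unlift_none.
Qed.

Lemma measurable_row_behead n : measurable_fun setT (@row_behead n).
Proof.
apply: measurable_fun_row => i.
rewrite (_ : (fun _ => _) = (fun w : 'rV[R]_n.+1 => w 0 (lift ord0 i))).
  exact: measurable_coord.
by apply/funext => w; rewrite mxE.
Qed.

Section LebesgueStep.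
Context n (m : {sigma_finite_measure set 'rV[R]_n -> \bar R}).

Definition lebesgue_step : set 'rV[R]_n.+1 -> \bar R :=
  image_measure (@lebesgue_measure R \x m)%E (@measurable_row_cons n).

HB.instance Definition _ := Measure.on lebesgue_step.

Let step_sigma_finite : sigma_finite setT lebesgue_step.
Proof.
have /sigma_finiteP[F [FT ndF Foo]] := sigma_finiteT (@lebesgue_measure R).
have /sigma_finiteP[G [GT ndG Goo]] := sigma_finiteT m.
exists (fun k => [set w : 'rV[R]_n.+1 | F k (w 0 0) /\ G k (row_behead w)]).
  apply/esym; rewrite -subTset => w _.
  have [i _ Fi] : (\bigcup_k F k) (w 0 0) by rewrite -FT.
  have [j _ Gj] : (\bigcup_k G k) (row_behead w) by rewrite -GT.
  exists (maxn i j) => //; split.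
    by move: Fi; exact/subsetPset/ndF/leq_maxl.
  by move: Gj; exact/subsetPset/ndG/leq_maxr.
move=> k; have [mF Fk] := Foo k; have [mG Gk] := Goo k; split.
  apply: measurableI; rewrite -[X in measurable X]setTI.
    exact: measurable_coord.
  exact: measurable_row_behead.
rewrite /lebesgue_step /= /pushforward.
rewrite (_ : _ @^-1` _ = F k `*` G k).
  by rewrite product_measure1E// lte_mul_pinfty// ge0_fin_numE.
apply/seteqP; split=> -[x v] /=; rewrite /row_cons mxE unlift_none/=;
  by rewrite [row_behead _](_ : _ = v)//; apply/rowP => j; rewrite !mxE liftK.
Qed.

HB.instance Definition _ := Measure_isSigmaFinite.Build _ _ _
  lebesgue_step step_sigma_finite.

End LebesgueStep.

(* Lebesgue measure on R^n, as an iterated product. *)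
Fixpoint lebesgue_row n : {sigma_finite_measure set 'rV[R]_n -> \bar R} :=
  if n is m.+1 then lebesgue_step (lebesgue_row m) else \d_(0 : 'rV[R]_0).
End LebesgueRow.

Definition time_interval (R : realType) (tN : R) : set R := `]0, tN]%classic.

(* [time_derive I g t] is the derivative of [g] at [t] relative to [I]; at the
   right end point of an interval it is the left derivative. *)
Section TimeDerivative.
Context (R : realType) (W : normedModType R).
Implicit Types (I : set R) (g : R -> W).

Definition time_quotient g (t s : R) : W := (s - t)^-1 *: (g s - g t).

Definition is_time_derive I g t (l : W) :=
  time_quotient g t s @[s --> within I t^'] --> l.

Definition time_derivable I g t := cvg (time_quotient g t @ within I t^').

Definition time_derive I g t : W := lim (time_quotient g t @ within I t^').

End TimeDerivative.

Section Vectors.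
Context (R : realType) (d : nat).
Implicit Types (a b : 'rV[R]_d) (A B : 'M[R]_d).

Definition dot a b : R := \sum_i a 0 i * b 0 i.

(* The norm that the library puts on rows is the max norm. *)
Definition enorm a : R := Num.sqrt (dot a a).

Definition outer a b : 'M[R]_d := \matrix_(i, j) (a 0 i * b 0 j).

Definition ddot A B : R := \sum_i \sum_j A i j * B i j.

Definition tensor_apply A b : 'rV[R]_d := \row_i \sum_j A i j * b 0 j.

Definition gradient (q : 'rV[R]_d -> R) (x : 'rV[R]_d) : 'rV[R]_d :=
  \row_j 'D_(delta_mx 0 j) q x.

Definition vgradient (v : 'rV[R]_d -> 'rV[R]_d) (x : 'rV[R]_d) : 'M[R]_d :=
  \matrix_(i, j) 'D_(delta_mx 0 j) (fun y => v y 0 i) x.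

Definition vintegral (mu : {measure set 'rV[R]_d -> \bar R})
    (D : set 'rV[R]_d) (v : 'rV[R]_d -> 'rV[R]_d) : 'rV[R]_d :=
  \row_i \int[mu]_(x in D) v x 0 i.

Definition L2 (mu : {measure set 'rV[R]_d -> \bar R}) (D : set 'rV[R]_d)
    (v : 'rV[R]_d -> 'rV[R]_d) :=
  forall i, ((fun x => v x 0 i) \_ D) \in Lfun mu 2%:E.

(* [msize p <= l.+1] says that the total degree of [p] is at most [l]. *)
Definition poly_on (l : nat) (D : set 'rV[R]_d) (q : 'rV[R]_d -> R) :=
  exists2 p : mpoly d R, (msize p <= l.+1)%N &
    forall x, D x -> q x = meval (x 0) p.

Definition frontier (D : set 'rV[R]_d) := closure D `\` D°.

End Vectors.

(* A simplex is given by the set [S : {set V}] of its vertices, [z] being the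
   position of the vertices; a cell has d.+1 vertices and a facet d. *)
Section Mesh.
Context (R : realType) (d : nat) (V : finType) (z : V -> 'rV[R]_d).
Implicit Types (S K F : {set V}) (T : {set {set V}}) (Omega : set 'rV[R]_d).

Definition hull S : set 'rV[R]_d :=
  [set x | exists w : V -> R, [/\ forall v, v \in S -> 0 <= w v,
    \sum_(v in S) w v = 1 & x = \sum_(v in S) w v *: z v]].

(* Cells are open simplices. *)
Definition cell K : set 'rV[R]_d := (hull K)°.

Definition affine_independent S :=
  forall w : V -> R, \sum_(v in S) w v = 0 -> \sum_(v in S) w v *: z v = 0 ->
    forall v, v \in S -> w v = 0.

(* Slit domains are excluded by [Omega = (closure Omega)°]. *)
Definition triangulation Omega T :=
  [/\ [/\ open Omega, connected Omega, Omega !=set0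
        & Omega = (closure Omega)°],
      forall K, K \in T -> #|K| = d.+1 /\ affine_independent K,
      forall K K', K \in T -> K' \in T ->
        hull K `&` hull K' = hull (K :&: K')
    & closure Omega = \bigcup_(K in [set K | K \in T]) hull K].

Definition facets_of K : {set {set V}} :=
  [set F : {set V} | (F \subset K) && (#|F| == d)]%SET.

Definition facets T : {set {set V}} := (\bigcup_(K in T) facets_of K)%SET.

Definition boundary_facet Omega F : bool := `[< hull F `<=` frontier Omega >].

(* Unit vector orthogonal to F and pointing away from the vertex of K opposite
   to F. *)
Definition is_outward_normal K F (a : 'rV[R]_d) :=
  [/\ enorm a = 1,
      forall v w, v \in F -> w \in F -> dot (z v - z w) a = 0
    & forall v w, v \in K -> v \notin F -> w \in F -> dot (z v - z w) a < 0].

Definition outward_normal K F : 'rV[R]_d :=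
  xget 0 [set a | is_outward_normal K F a].

Definition diam K : R :=
  sup [set enorm (x - y) | x in hull K & y in hull K].

(* Surface measure of the flat facet F with vertices a_0, ..., a_(d-1): image of
   Lebesgue measure on the reference simplex of R^(d-1) under
   s |-> a_0 + sum_j s_j (a_(j+1) - a_0), scaled by the square root of the Gram
   determinant of the edges. *)
Definition vertices F : seq 'rV[R]_d := [seq z v | v <- enum F].

Definition edges F : 'M[R]_(d.-1, d) :=
  \matrix_(j < d.-1) ((vertices F)`_j.+1 - (vertices F)`_0).

Definition facet_param F (s : 'rV[R]_d.-1) : 'rV[R]_d :=
  (vertices F)`_0 + s *m edges F.

Definition reference_simplex n : set 'rV[R]_n :=
  [set s | (forall j, 0 <= s 0 j) /\ \sum_j s 0 j <= 1].

Lemma measurable_facet_param F : measurable_fun setT (facet_param F).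
Proof.
apply: measurable_fun_row => i.
rewrite (_ : (fun _ => _) = fun s : 'rV[R]_d.-1 =>
    (vertices F)`_0 0 i + \sum_j s 0 j * edges F j i); last first.
  by apply/funext => s; rewrite /facet_param !mxE.
apply: measurable_funD; first exact: measurable_cst.
apply: measurable_sum => j; apply: measurable_funM; last exact: measurable_cst.
exact: measurable_coord.
Qed.

Lemma measurable_reference_simplex n : measurable (@reference_simplex n).
Proof.
have -> : @reference_simplex n = (\bigcap_j [set s | 0 <= s 0 j])
    `&` [set s | \sum_j s 0 j <= 1].
  apply/seteqP; split=> s /= [s0 s1]; split=> // j;
    first by move=> _; exact: s0.
  exact: s0.
apply: measurableI.
  apply: fin_bigcap_measurable => // j _.
  rewrite [X in measurable X](_ : _ =
      (fun s : 'rV[R]_n => s 0 j) @^-1` `[0, +oo[%classic).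
    rewrite -[X in measurable X]setTI; exact: measurable_coord.
  by apply/seteqP; split=> s /=; rewrite in_itv/= andbT.
rewrite [X in measurable X](_ : _ =
  (fun s : 'rV[R]_n => \sum_j s 0 j) @^-1` `]-oo, 1]%classic).
  rewrite -[X in measurable X]setTI; apply: measurable_sum => // j.
  exact: measurable_coord.
by apply/seteqP; split=> s /=; rewrite in_itv.
Qed.

Definition facet_measure F : {measure set 'rV[R]_d -> \bar R} :=
  mscale (NngNum (sqrtr_ge0 (\det (edges F *m (edges F)^T))))
    (image_measure (mrestr (lebesgue_row R d.-1)
                           (@measurable_reference_simplex d.-1))
                   (measurable_facet_param F)).

Definition cell_boundary_integral K (g : {set V} -> 'rV[R]_d -> R) : R :=
  \sum_(F in facets_of K) \int[facet_measure F]_(x in hull F) g F x.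

(* A boundary facet belongs to exactly one cell, so that each boundary facet is
   counted once; the integrand may use traces from that cell. *)
Definition boundary_integral Omega T (A : set 'rV[R]_d)
    (g : {set V} -> {set V} -> 'rV[R]_d -> R) : R :=
  \sum_(K in T) \sum_(F in facets_of K | boundary_facet Omega F)
    \int[facet_measure F]_(x in hull F `&` A) g K F x.

(* The restriction to a cell K of an element of V_h or Q_h is identified with
   the polynomial on R^d extending it, so that values and derivatives at points
   of the boundary of K are the traces from inside K. *)
Definition in_V T (k : nat) (v : {set V} -> 'rV[R]_d -> 'rV[R]_d) :=
  forall K, K \in T -> forall i, poly_on k setT (fun x => v K x 0 i).

Definition in_Q T (k : nat) (q : {set V} -> 'rV[R]_d -> R) :=
  forall K, K \in T -> poly_on k.-1 setT (q K).

Definition in_Vbar T (k : nat) (GammaD : set 'rV[R]_d)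
    (v : {set V} -> 'rV[R]_d -> 'rV[R]_d) :=
  forall F, F \in facets T ->
    (forall i, poly_on k (hull F) (fun x => v F x 0 i)) /\
    {ae facet_measure F, forall x, (hull F `&` GammaD) x -> v F x = 0}.

Definition in_Qbar T (k : nat) (q : {set V} -> 'rV[R]_d -> R) :=
  forall F, F \in facets T -> poly_on k (hull F) (q F).

(* The function on Omega given by a cellwise function; its value 0 on the cell
   boundaries, a null set, is irrelevant. *)
Definition broken_fun T (v : {set V} -> 'rV[R]_d -> 'rV[R]_d) (x : 'rV[R]_d) :
    'rV[R]_d :=
  \sum_(K in T) \1_(cell K) x *: v K x.

Section Problem.
Context (Omega GammaD GammaN : set 'rV[R]_d) (T : {set {set V}}) (k : nat)
  (nu alpha : R).
Context (f h : 'rV[R]_d -> 'rV[R]_d).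
Context (u dtu : {set V} -> 'rV[R]_d -> 'rV[R]_d)
  (ubar : {set V} -> 'rV[R]_d -> 'rV[R]_d)
  (p pbar : {set V} -> 'rV[R]_d -> R).

Local Notation lebesgue := (lebesgue_row R d).

Definition upwind K F x : R :=
  if dot (u K x) (outward_normal K F) < 0 then 1 else 0.

Definition sigma K x : 'M[R]_d :=
  outer (u K x) (u K x) + ((p K x)%:M - nu *: vgradient (u K) x).

Definition sigma_hat_a K F x : 'M[R]_d :=
  outer (u K x) (u K x) + outer (ubar F x - u K x) (upwind K F x *: u K x).

Definition sigma_hat_d K F x : 'M[R]_d :=
  (pbar F x)%:M - nu *: vgradient (u K) x
  - (nu * alpha / diam K) *: outer (ubar F x - u K x) (outward_normal K F).

Definition sigma_hat K F x : 'M[R]_d := sigma_hat_a K F x + sigma_hat_d K F x.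

Definition cell_continuity := forall q, in_Q T k q ->
  0 = \sum_(K in T) \int[lebesgue]_(x in cell K) dot (u K x) (gradient (q K) x)
    - \sum_(K in T) cell_boundary_integral K
        (fun F x => dot (u K x) (outward_normal K F) * q K x).

Definition facet_continuity := forall qbar, in_Qbar T k qbar ->
  0 = \sum_(K in T) cell_boundary_integral K
        (fun F x => dot (u K x) (outward_normal K F) * qbar F x)
    - boundary_integral Omega T (frontier Omega)
        (fun K F x => dot (ubar F x) (outward_normal K F) * qbar F x).

Definition cell_momentum := forall v, in_V T k v ->
  \int[lebesgue]_(x in Omega) dot (f x) (broken_fun T v x) =
    \int[lebesgue]_(x in Omega) dot (broken_fun T dtu x) (broken_fun T v x)
    - \sum_(K in T) \int[lebesgue]_(x in cell K)
        ddot (sigma K x) (vgradient (v K) x)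
    + \sum_(K in T) cell_boundary_integral K
        (fun F x => ddot (sigma_hat K F x) (outer (v K x) (outward_normal K F)))
    + \sum_(K in T) cell_boundary_integral K
        (fun F x => ddot (nu *: outer (ubar F x - u K x) (outward_normal K F))
                         (vgradient (v K) x)).

Definition facet_momentum := forall vbar, in_Vbar T k GammaD vbar ->
  boundary_integral Omega T GammaN (fun K F x => dot (h x) (vbar F x)) =
    \sum_(K in T) cell_boundary_integral K
      (fun F x => ddot (sigma_hat K F x)
                       (outer (vbar F x) (outward_normal K F)))
    - boundary_integral Omega T GammaN
        (fun K F x => (1 - upwind K F x) * dot (ubar F x) (outward_normal K F)
                      * dot (ubar F x) (vbar F x)).

Definition semi_discrete_problem :=
  [/\ [/\ in_V T k u, in_Vbar T k GammaD ubar, in_Q T k p & in_Qbar T k pbar],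
      cell_continuity, facet_continuity, cell_momentum & facet_momentum].

End Problem.

End Mesh.

(* Main.v *)
Require Import Defs.
From mathcomp Require Import all_boot all_order all_algebra.
From mathcomp Require Import -(notations) mpoly.
From mathcomp Require Import all_classical all_reals all_analysis.
From mathcomp Require Import measurable_realfun.
Set Implicit Arguments.
Unset Strict Implicit.
Unset Printing Implicit Defensive.

Import Order.TTheory GRing.Theory Num.Theory numFieldNormedType.Exports.
Local Open Scope classical_set_scope.
Local Open Scope ring_scope.

(** Test the cell momentum equation with the function equal to the unit vector
    [e_i] on one cell [K] and to zero on the other cells. Its broken gradient
    vanishes, and what remains is, in the [i]-th component,
      integral over K of d_t u_h
        = integral over K of f - integral over the boundary of K of
          (sigma_hat n)
    ([cell_balance]). This uses the fact that each cell lies in the domain and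
    that distinct cells are disjoint: the vertices shared by two distinct cells
    span an affine subspace of dimension less than [d], which has empty interior
    ([interior_hull_small]).

    The first claim then asks to exchange the time derivative with the integral
    over [K], knowing only that [u_h] is differentiable in time at each point of
    [K]. Polynomials of bounded degree form a finite-dimensional space, so on
    the simplex they are given by a formula of Lagrange type
    [q y = sum_j L_j y * q (x_j)] with fixed points [x_j] and fixed polynomials
    [L_j] ([poly_interpolation]). Hence both the integral of [u_h] over [K] and
    the integral of [d_t u_h] are the same fixed linear combination of the
    values at the points [x_j], and differentiation at these finitely many
    points is enough ([is_time_derive_vintegral]).

    If there is no Dirichlet boundary, the constant [e_i] is an admissible test
    function in the facet momentum equation; it expresses the sum over the cells
    of the boundary terms through the boundary of the domain
    ([facet_balance]). The second claim is the sum of the first one over the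
    cells. The cells cover the domain up to a null set ([negligible_skeleton]),
    because a point of a simplex outside its interior has a vanishing
    barycentric coordinate and hyperplanes are null sets
    ([lebesgue_row_hyperplane]). *)

(** * Limits and integrals of finite sums *)

Lemma cvg_sum_normed (R : realType) (W : normedModType R) (I J : Type)
    (F : set_system J) {FF : Filter F} (r : seq I) (P : pred I)
    (g : I -> J -> W) (l : I -> W) :
  (forall i, P i -> g i x @[x --> F] --> l i) ->
  \sum_(i <- r | P i) g i x @[x --> F] --> \sum_(i <- r | P i) l i.
Proof. by move=> gl; apply: cvg_big => //; exact: add_continuous. Qed.

Lemma Rintegral_sum (R : realType) dT (X : measurableType dT)
    (mu : {measure set X -> \bar R})
    (D : set X) (I : Type) (r : seq I) (P : pred I) (g : I -> X -> R) :
  measurable D -> (forall i, P i -> mu.-integrable D (EFin \o g i)) ->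
  \int[mu]_(x in D) (\sum_(i <- r | P i) g i x) =
  \sum_(i <- r | P i) \int[mu]_(x in D) g i x.
Proof.
move=> mD ig; elim: r => [|i r IH].
  under eq_Rintegral do rewrite big_nil.
  by rewrite big_nil Rintegral_cst// mul0r.
under eq_Rintegral do rewrite big_cons.
rewrite big_cons; case: ifP => // Pi.
rewrite RintegralD//; [by rewrite IH|exact: ig|].
rewrite (_ : _ \o _ = fun x => (\sum_(i <- r | P i) (g i x)%:E)%E).
  by apply: integrable_sum => //; exact: ig.
by apply/funext => x /=; rewrite sumEFin.
Qed.

Lemma indicM_patch (R : realType) (X : Type) (A : set X) (g : X -> R) :
  (fun x => \1_A x * g x) = g \_ A.
Proof.
by apply/funext => x; rewrite patchE indicE; case: ifP => _;
  rewrite ?mul1r ?mul0r.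
Qed.

(** * Lebesgue measure on rows *)

Lemma measurable_coord_preimage (R : realType) (n : nat) (i : 'I_n)
    (B : set R) :
  measurable B -> measurable [set x : 'rV[R]_n | B (x 0 i)].
Proof.
by move=> mB; rewrite -[X in measurable X]setTI; exact: measurable_coord.
Qed.

(** An open set is a countable union of boxes with rational centres and radii,
    hence belongs to the product sigma-algebra. *)
Lemma open_measurable_row (R : realType) (n : nat) (U : set 'rV[R]_n) :
  open U -> measurable U.
Proof.
move=> oU.
pose box (c : {ffun 'I_n -> rat} * rat) : set 'rV[R]_n :=
  [set y | forall i, ball (ratr (c.1 i) : R) (ratr c.2) (y 0 i)].
pose inner c : set 'rV[R]_n := if `[< box c `<=` U >] then box c else set0.
have -> : U = \bigcup_c inner c.
  apply/seteqP; split=> [x Ux|x [c _]]; last first.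
    by rewrite /inner; case: asboolP => // + bx; exact.
  have /nbhs_ballP[e /= e0 eU] : nbhs x U by exact: open_nbhs_nbhs.
  have e20 : 0 < e / 2 by rewrite divr_gt0.
  have [r] := rat_in_itvoo e20; rewrite in_itv/= => /andP[r0 re].
  have qP (i : 'I_n) : exists q : rat, ball (ratr q : R) (ratr r) (x 0 i).
    have : x 0 i - ratr r < x 0 i + ratr r.
      by rewrite ltrBlDr -addrA ltrDl addr_gt0.
    move=> /rat_in_itvoo[q]; rewrite in_itv/= => /andP[q1 q2]; exists q.
    by rewrite /ball/= ltr_distl q1 q2.
  have [q qx] := choice qP.
  have bx : box ([ffun i => q i], r) x by move=> i /=; rewrite ffunE; exact: qx.
  exists ([ffun i => q i], r) => //; rewrite /inner; case: asboolP => // nb.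
  case: nb => y yb; apply: eU; split=> // i j; rewrite ord1 [e]splitr.
  apply: (le_ball (lerD (ltW re) (ltW re))).
  by apply: ball_triangle (yb j); apply: ball_sym; exact: bx.
apply: countable_bigcupT_measurable => // c.
rewrite /inner; case: asboolP => // _.
rewrite (_ : box c = \bigcap_i [set y : 'rV[R]_n |
    ball (ratr (c.1 i) : R) (ratr c.2) (y 0 i)]); last first.
  by apply/seteqP; split=> y yb i //; [move=> _|]; exact: yb.
apply: fin_bigcap_measurable; [exact: finite_finset|move=> i _].
exact: (measurable_coord_preimage i (measurable_ball _ _)).
Qed.

(** The cube [-M, M]^n. *)
Definition row_cube (R : realType) (n : nat) (M : R) : set 'rV[R]_n :=
  [set x | forall i, x 0 i \in `[- M, M]].
Arguments row_cube {R} n M.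

Lemma measurable_row_cube (R : realType) (n : nat) (M : R) :
  measurable (row_cube n M).
Proof.
rewrite (_ : row_cube n M = \bigcap_i [set x : 'rV[R]_n | x 0 i \in `[- M, M]]).
  apply: fin_bigcap_measurable; [exact: finite_finset|move=> i _].
  by apply: (@measurable_coord_preimage R n i `[- M, M]%classic).
by apply/seteqP; split=> y yb i //; [move=> _|]; exact: yb.
Qed.

Lemma lebesgue_row_cube_lty (R : realType) (n : nat) (M : R) :
  (lebesgue_row R n (row_cube n M) < +oo)%E.
Proof.
elim: n => [|n IH].
  by rewrite /= diracE ltry.
rewrite /= /lebesgue_step /= /pushforward.
rewrite (_ : _ @^-1` _ = `[- M, M]%classic `*` row_cube n M).
  rewrite product_measure1E//; last exact: measurable_row_cube.
  have lM : (@lebesgue_measure R `[(- M)%R, M]%classic < +oo)%E.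
    by rewrite lebesgue_measure_itv; case: ifP => _; rewrite ?ltry.
  by rewrite lte_mul_pinfty// ge0_fin_numE.
apply/seteqP; split=> -[x v] /=.
  move=> H; split; first by have := H ord0; rewrite mxE unlift_none.
  by move=> i; have := H (lift ord0 i); rewrite mxE liftK.
move=> [xM vM] i; rewrite mxE.
by case: (unliftP ord0 i) => [j|] _.
Qed.

Lemma measurable_fun_affine (R : realType) (n : nat) (a : 'rV[R]_n) (c : R) :
  measurable_fun setT (fun x : 'rV[R]_n => c + dot x a).
Proof.
apply: measurable_funD => //; apply: measurable_sum => i.
by apply: measurable_funM => //; exact: measurable_coord.
Qed.

Lemma measurable_hyperplane (R : realType) (n : nat) (a : 'rV[R]_n) (c : R) :
  measurable [set x : 'rV[R]_n | c + dot x a = 0].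
Proof.
have := measurable_fun_affine a c measurableT (measurable_set1 (0 : R)).
by rewrite setTI.
Qed.

(** The zero set of a nonzero affine function is a null set: by Fubini, all
    slices, except possibly one, are null. *)
Lemma lebesgue_row_hyperplane (R : realType) (n : nat) (a : 'rV[R]_n) (c : R) :
  (a != 0) || (c != 0) -> lebesgue_row R n [set x | c + dot x a = 0] = 0%E.
Proof.
elim: n a c => [|n IH] a c.
  rewrite thinmx0 eqxx /= => c0; rewrite diracE memNset//=.
  by rewrite /dot big_ord0 addr0; apply/eqP.
move=> ac; rewrite /= /lebesgue_step /= /pushforward.
rewrite /product_measure1.
pose a' := row_behead a.
have -> : @row_cons R n @^-1` [set x : 'rV_n.+1 | c + dot x a = 0] =
   [set xv | (c + xv.1 * a 0 0) + dot xv.2 a' = 0].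
  apply/seteqP; split=> -[x v] /=; rewrite /dot big_ord_recl /row_cons !mxE
    unlift_none /= => h; rewrite -[RHS]h -addrA;
    by do 2 congr (_ + _); apply: eq_bigr => i _; rewrite !mxE liftK.
have slice x : (lebesgue_row R n \o xsection [set xv : R * 'rV[R]_n |
      (c + xv.1 * a 0 0) + dot xv.2 a' = 0]) x =
   lebesgue_row R n [set v | (c + x * a 0 0) + dot v a' = 0].
  by rewrite /= /xsection/=; congr (lebesgue_row R n _);
     apply/seteqP; split => v /=; rewrite inE.
have [a'0|a'0] := eqVneq a' 0; last first.
  by rewrite integral0_eq// => x _; rewrite slice IH// a'0.
have [a00|a00] := eqVneq (a 0 0) 0.
  have a0 : a = 0.
    apply/rowP => i; case: (unliftP ord0 i) => [j|] ->; last by rewrite a00 mxE.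
    by move/rowP : a'0 => /(_ j); rewrite !mxE.
  rewrite integral0_eq// => x _; rewrite slice IH// a00 mulr0 addr0.
  by move: ac; rewrite a0 eqxx => /= ->; rewrite orbT.
(* Only the slice at [- c / a 0 0] is the whole space. *)
rewrite (_ : 0%E = \int[@lebesgue_measure R]_(x in setT) (cst 0 x))%E;
  last by rewrite integral0.
apply: ae_eq_integral => //.
  apply: measurable_fun_xsection.
  have mh : measurable_fun setT
      (fun xv : R * 'rV[R]_n => c + xv.1 * a 0 0 + dot xv.2 a').
    apply: measurable_funD.
      by apply: measurable_funD => //; apply: measurable_funM.
    rewrite (_ : (fun _ => _) = (fun v => 0 + dot v a') \o snd); last first.
      by apply/funext => x/=; rewrite add0r.
    by apply: measurableT_comp => //; exact: measurable_fun_affine.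
  by have := mh measurableT _ (measurable_set1 0); rewrite setTI.
exists [set - c / a 0 0].
split; [exact: measurable_set1|exact: lebesgue_measure_set1|].
move=> x /=; apply: contra_notP => xc _.
apply: (etrans (slice x)); rewrite IH// a'0 eqxx/=; apply/eqP => h; apply: xc.
by rewrite -[x](mulfK a00) -(addKr c (x * _)) h addr0.
Qed.

(** A nonzero affine function does not vanish on a nonempty open set. *)
Lemma interior_hyperplane (R : realType) (n : nat) (a : 'rV[R]_n) (c : R) :
  (a != 0) || (c != 0) -> [set x | c + dot x a = 0]° = set0.
Proof.
move=> ac; rewrite -subset0 => x /nbhs_ballP[e /= e0 ex].
have dotD y w : dot (y + w) a = dot y a + dot w a.
  by rewrite /dot -big_split; apply: eq_bigr => i _; rewrite mxE mulrDl.
have x0 : c + dot x a = 0 by apply: ex; exact: ballxx.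
have a0 : a = 0.
  apply/rowP => i; rewrite mxE.
  have : c + dot (x + (e / 2) *: delta_mx 0 i) a = 0.
    apply: ex; split=> // j l.
    rewrite !mxE !ord1 /ball/= opprD addrA subrr sub0r.
    rewrite normrN; case: (l == i) => /=; rewrite ?mulr0 ?normr0// mulr1.
    by rewrite gtr0_norm ?divr_gt0// ltr_pdivrMr// ltr_pMr// ltr1n.
  rewrite dotD addrA x0 add0r /dot (bigD1 i)//= big1 ?addr0; last first.
    by move=> j ji; rewrite !mxE eqxx (negPf ji) mulr0 mul0r.
  rewrite !mxE !eqxx mulr1 => /eqP; rewrite !mulf_eq0 invr_eq0 pnatr_eq0/= orbF.
  by rewrite (gt_eqF e0)/= => /eqP.
move: ac x0; rewrite a0 eqxx/= => /eqP c0.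
by rewrite /dot big1 ?addr0// => i _; rewrite mxE mulr0.
Qed.

(** * Simplices and triangulations *)

Section Simplex.
Context (R : realType) (d : nat) (V : finType) (z : V -> 'rV[R]_d).
Implicit Types (S K : {set V}) (x : 'rV[R]_d).

(** Homogeneous coordinates (1, z v) of the vertices of a simplex, one row per
    vertex. *)
Definition homogeneous S : 'M[R]_(#|S|, 1 + d) :=
  row_mx (const_mx 1) (\matrix_(j < #|S|) z (enum_val j)).

Lemma mul_homogeneous S (w : 'rV[R]_#|S|) :
  w *m homogeneous S =
  row_mx (\sum_j w 0 j)%:M (\sum_j w 0 j *: z (enum_val j)).
Proof.
rewrite /homogeneous mul_mx_row; congr row_mx.
  apply/rowP => i; rewrite !mxE ord1 eqxx mulr1n.
  by apply: eq_bigr => j _; rewrite mxE mulr1.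
by rewrite mulmx_sum_row; apply: eq_bigr => j _; rewrite rowK.
Qed.

Lemma hull_homogeneous S x : hull z S x ->
  exists2 w : 'rV[R]_#|S|, (forall j, 0 <= w 0 j) &
    row_mx 1%:M x = w *m homogeneous S.
Proof.
move=> [w [w0 w1 ->]]; exists (\row_j w (enum_val j)).
  by move=> j; rewrite mxE; exact/w0/enum_valP.
rewrite mul_homogeneous; congr row_mx.
  by rewrite -w1 big_enum_val; congr (_%:M); apply: eq_bigr => j _; rewrite mxE.
by rewrite big_enum_val; apply: eq_bigr => j _; rewrite mxE.
Qed.

(** Weights indexed by the enumeration of [S] are the values of a function on
    all vertices. *)
Lemma enum_val_weights S (w : 'rV[R]_#|S|) :
  {g : V -> R | forall j : 'I_#|S|, g (enum_val j) = w 0 j}.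
Proof.
exists (fun v => \sum_(j < #|S| | enum_val j == v) w 0 j) => j.
rewrite (big_pred1 j)// => i; apply/eqP/eqP => [|-> //].
exact: enum_val_inj.
Qed.

Lemma homogeneous_hull S x (w : 'rV[R]_#|S|) : (forall j, 0 <= w 0 j) ->
  row_mx 1%:M x = w *m homogeneous S -> hull z S x.
Proof.
move=> w0; rewrite mul_homogeneous => /eq_row_mx[w1 ->].
have [g gw] := enum_val_weights w; exists g; split.
- move=> v vS; rewrite -(enum_rankK_in vS vS) gw; exact: w0.
- rewrite big_enum_val; rewrite (eq_bigr _ (fun j _ => gw j)).
  by move/matrixP : w1 => /(_ 0 0); rewrite !mxE.
- by rewrite [RHS]big_enum_val; apply: eq_bigr => j _; rewrite gw.
Qed.

Lemma row_free_homogeneous S :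
  affine_independent z S -> row_free (homogeneous S).
Proof.
move=> affS; apply: inj_row_free => w wS0.
have := mul_homogeneous w; rewrite wS0 -[LHS]row_mx0 => /eq_row_mx[w1 w2].
have [g gw] := enum_val_weights w.
apply/rowP => j; rewrite -gw mxE; apply: affS (enum_valP j).
  rewrite big_enum_val; rewrite (eq_bigr _ (fun j _ => gw j)).
  by move/matrixP : w1 => /(_ 0 0); rewrite !mxE eqxx mulr1n.
by rewrite big_enum_val [RHS]w2; apply: eq_bigr => i _; rewrite gw.
Qed.

(** A linear form in homogeneous coordinates is an affine function. *)
Lemma mul_row_mx1 n (B : 'M[R]_(1 + d, n)) x j :
  (row_mx 1%:M x *m B) 0 j = B (lshift d 0) j +
    dot x (\row_i B (rshift 1 i) j).
Proof.
rewrite -[B in LHS]vsubmxK mul_row_col mul1mx !mxE; congr (_ + _).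
by apply: eq_bigr => i _; rewrite !mxE.
Qed.

(** Fewer than [d + 1] points satisfy a nontrivial affine equation, whose
    coefficients form a vector annihilated by their homogeneous coordinates. *)
Lemma interior_hull_small S : (#|S| <= d)%N -> (hull z S)° = set0.
Proof.
move=> Sd; have : kermx (homogeneous S)^T != 0.
  rewrite kermx_eq0 -row_leq_rank -ltnNge mxrank_tr.
  by apply: leq_ltn_trans (rank_leq_row _) _; rewrite add1n ltnS.
move=> /rowV0Pn[b /sub_kermxP bS b0].
have Sb : homogeneous S *m b^T = 0.
  by apply: trmx_inj; rewrite trmx_mul trmxK bS trmx0.
pose a := \row_i b^T (rshift 1 i) 0; pose c := b^T (lshift d 0) 0.
rewrite -subset0 -(@interior_hyperplane _ _ a c).
  apply: interiorS => x /hull_homogeneous[w _ xw] /=.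
  by rewrite -mul_row_mx1 xw -mulmxA Sb mulmx0 mxE.
apply: contraNT b0; rewrite negb_or !negbK => /andP[/eqP a0 /eqP c0].
apply/eqP/rowP => i; rewrite mxE -[i]splitK; case: (fintype.split i) => j /=.
  by rewrite -[RHS]c0 /c mxE ord1.
by move/rowP : a0 => /(_ j); rewrite !mxE.
Qed.

Lemma continuous_affine (a : 'rV[R]_d) (c : R) :
  continuous (fun x : 'rV[R]_d => c + dot x a).
Proof.
move=> x; apply: (@cvgD _ _ _ (nbhs x)); first exact: cvg_cst.
apply: (@cvg_sum_normed _ R^o _ _ (nbhs x)) => i _.
apply: (@cvgM _ _ (nbhs x)); [exact: coord_continuous|exact: cvg_cst].
Qed.

(** Simplices are bounded. *)
Lemma hull_sub_cube S : exists M, hull z S `<=` row_cube d M.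
Proof.
exists (\sum_v \sum_i `|z v 0 i|) => x [w [w0 w1 ->]] i.
set M := (X in `[- X, X]).
have zM v : `|z v 0 i| <= M.
  rewrite /M (bigD1 v)//= (bigD1 i)//= -addrA lerDl addr_ge0// ?sumr_ge0//.
  by move=> u _; exact: sumr_ge0.
rewrite in_itv/= -ler_norml summxE -[M]mul1r -w1 mulr_suml.
apply: le_trans (ler_norm_sum _ _ _) _; apply: ler_sum => v vS.
by rewrite mxE normrM (ger0_norm (w0 v vS)) ler_wpM2l// w0.
Qed.

Lemma measurable_cell K : measurable (cell z K).
Proof. by apply: open_measurable_row; exact: open_interior. Qed.

(** A point of a simplex outside its interior has a vanishing barycentric
    coordinate, hence lies in one of finitely many hyperplanes. *)
Lemma negligible_hull_cell K : #|K| = d.+1 -> affine_independent z K ->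
  (lebesgue_row R d).-negligible (hull z K `\` cell z K).
Proof.
move=> cK /row_free_homogeneous frK.
have fuK : row_full (homogeneous K).
  by rewrite /row_full (eqnP frK) cK.
pose B := pinvmx (homogeneous K).
pose c (j : 'I_#|K|) := B (lshift d 0) j.
pose a (j : 'I_#|K|) : 'rV_d := \row_i B (rshift 1 i) j.
have ac j : (a j != 0) || (c j != 0).
  have : (homogeneous K *m B) j j = 1 by rewrite mulmxVp// mxE eqxx.
  apply: contra_eqT; rewrite negb_or !negbK => /andP[/eqP a0 /eqP c0].
  rewrite mxE big1 ?(eq_sym 0) ?oner_eq0// => i _.
  suff -> : B i j = 0 by rewrite mulr0.
  rewrite -[i]splitK; case: (fintype.split i) => l /=.
    by rewrite -[RHS]c0 ord1.
  by move/rowP : a0 => /(_ l); rewrite !mxE.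
(* The entries of [row_mx 1%:M x *m B] are the barycentric coordinates of [x],
   namely the affine functions [c j + dot x (a j)]. *)
have xB x : row_mx 1%:M x = (row_mx 1%:M x *m B) *m homogeneous K.
  by rewrite mulmxKpV// submx_full.
apply: (@negligibleS _ _ _ _
  (\big[setU/set0]_j [set x | c j + dot x (a j) = 0])); last first.
  apply: big_ind => [|A A' ? ?|j _]; first exact: negligible_set0.
    exact: negligibleU.
  exists [set x | c j + dot x (a j) = 0]; split => //.
    exact: measurable_hyperplane.
  exact: lebesgue_row_hyperplane.
move=> x [Kx nKx]; rewrite -bigcup_seq; apply: contrapT => nx; apply: nKx.
have [w w0 xw] := hull_homogeneous Kx.
have wE j : w 0 j = c j + dot x (a j).
  by rewrite -mul_row_mx1 xw -mulmxA mulmxVp// mulmx1.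
have pos j : 0 < c j + dot x (a j).
  rewrite -wE lt_neqAle w0 andbT eq_sym; apply/eqP => wj; apply: nx.
  by exists j => /=; rewrite ?mem_index_enum// -wE.
have posn : \forall y \near nbhs x, forall j, 0 < c j + dot y (a j).
  apply: filter_forall => j.
  exact: (cvgr_gt _ (@continuous_affine (a j) (c j) x)).
apply: filterS posn => y ypos; apply: (@homogeneous_hull K y _ _ (xB y)) => j.
by rewrite mul_row_mx1 ltW.
Qed.

End Simplex.

Section Triangulation.
Context (R : realType) (d : nat) (V : finType) (z : V -> 'rV[R]_d).
Context (Omega : set 'rV[R]_d) (T : {set {set V}}).
Context (hT : triangulation z Omega T).

Lemma cell_sub_domain K : K \in T -> cell z K `<=` Omega.
Proof.
case: hT => -[_ _ _ OE] _ _ cO KT; rewrite OE cO.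
by apply: interiorS => x Kx; exists K.
Qed.

Lemma cell_disjoint K K' x : K \in T -> K' \in T -> cell z K x -> cell z K' x ->
  K = K'.
Proof.
case: hT => _ TK TI _ KT K'T Kx K'x; apply/eqP; apply: contrapT => /negP KK'.
have : (hull z (K :&: K'))° x by rewrite -TI// interiorI.
rewrite interior_hull_small// -ltnS -(TK K KT).1; apply: proper_card.
rewrite properE subsetIl/=; apply: contra KK' => KsK'.
rewrite eqEcard (TK _ KT).1 (TK _ K'T).1 leqnn andbT.
by apply: fintype.subset_trans KsK' (finset.subsetIr _ _).
Qed.

Lemma measurable_domain : measurable Omega.
Proof. by case: hT => -[oO _ _ _] _ _ _; exact: open_measurable_row. Qed.

Lemma lebesgue_domain_lty : (lebesgue_row R d Omega < +oo)%E.
Proof.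
have [M OM] : exists M, Omega `<=` row_cube d M.
  have /choice[M hM] : forall K, exists M, hull z K `<=` row_cube d M.
    by move=> K; exact: hull_sub_cube.
  exists (\sum_K `|M K|) => x /subset_closure.
  case: hT => _ _ _ -> [K _ /hM KM] i; move: (KM i).
  rewrite !in_itv/= -!ler_norml => /le_trans; apply.
  by rewrite (le_trans (ler_norm _))// (bigD1 K)//= lerDl sumr_ge0.
apply: le_lt_trans (lebesgue_row_cube_lty d M).
apply: le_measure; rewrite ?inE//; first exact: measurable_domain.
exact: measurable_row_cube.
Qed.

(** The cells cover the domain up to a null set, contained in the union of the
    boundaries of finitely many simplices. *)
Lemma negligible_skeleton :
  (lebesgue_row R d).-negligible [set x | Omega x /\
    forall K, K \in T -> ~ cell z K x].
Proof.
apply: (@negligibleS _ _ _ _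
  (\big[setU/set0]_(K in T) (hull z K `\` cell z K))); last first.
  apply: big_ind => [|A A' ? ?|K KT]; first exact: negligible_set0.
    exact: negligibleU.
  by case: hT => _ /(_ _ KT)[? ?] _ _; exact: negligible_hull_cell.
move=> x [/subset_closure]; case: hT => _ _ _ -> [K /= KT Kx] nK.
rewrite -bigcup_seq_cond; exists K; rewrite /= ?mem_index_enum//.
by split => //; exact: nK.
Qed.

End Triangulation.

(** * Interpolation of polynomials *)

(** Among the elements of a set of row vectors, finitely many span the rest. *)
Lemma finite_spanning_rows (F : fieldType) (N : nat) (E : set 'rV[F]_N) :
  exists r (A : 'M[F]_(r, N)), (forall j, E (row j A)) /\
    (forall e, E e -> (e <= A)%MS).
Proof.
(* As long as some element of [E] is not spanned, appending it raises the rank,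
   which is at most [N]. *)
suff H n r (A : 'M[F]_(r, N)) : (N - \rank A <= n)%N ->
    (forall j, E (row j A)) ->
    exists r (A : 'M[F]_(r, N)), (forall j, E (row j A)) /\
      (forall e, E e -> (e <= A)%MS).
  by apply: (@H N 0%N 0); [rewrite leq_subr|case].
elim: n r A => [|n IH] r A rA EA.
  exists r, A; split => // e _; apply: submx_full.
  by rewrite /row_full eqn_leq rank_leq_col -subn_eq0 -leqn0.
have [EsA|] := pselect (forall e, E e -> (e <= A)%MS); first by exists r, A.
move=> /existsNP[e /not_implyP[Ee /negP eA]].
apply: (IH _ (col_mx A e)); last first.
  move=> j; rewrite -[j]splitK; case: (fintype.split j) => i /=.
    by rewrite rowKu.
  by rewrite rowKd ord1 row_id.
have : (A < col_mx A e)%MS.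
  rewrite ltmxE col_mx_sub submx_refl/=; apply/andP; split; last exact: eA.
  by rewrite -addsmxE addsmxSl.
rewrite ltmxErank => /andP[_ lt].
by rewrite -ltnS (leq_trans _ rA)// ltn_sub2l// (leq_trans lt)// rank_leq_col.
Qed.

Section Polynomials.
Context (R : realType) (d : nat).
Implicit Types (q : 'rV[R]_d -> R).

(** The monomial function of exponent [m]. *)
Definition monomial (m : 'I_d -> nat) (x : 'rV[R]_d) : R :=
  \prod_i x 0 i ^+ m i.

Lemma poly_on_monomials k q : poly_on k setT q ->
  exists c : bmultinom d k.+1 -> R,
    forall x, q x = \sum_m c m * monomial m x.
Proof.
move=> [p pk qp]; exists (fun m => mcoeff m p) => x.
rewrite qp// {1}(mpolywE pk) raddf_sum/=; apply: eq_bigr => m _.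
by rewrite mevalZ mevalX.
Qed.

Lemma monomials_poly_on k (c : bmultinom d k.+1 -> R) :
  poly_on k setT (fun x => \sum_m c m * monomial m x).
Proof.
exists (\sum_m c m *: mpolyX R m).
  apply: (leq_trans (msize_sum _ _ _)); apply/bigmax_leqP => m _.
  apply: (leq_trans (msizeZ_le _ _)); rewrite msizeX; exact: bmdeg.
move=> x _; rewrite raddf_sum/=; apply: eq_bigr => m _.
by rewrite mevalZ mevalX.
Qed.

Lemma poly_on_cst k (D : set 'rV[R]_d) c : poly_on k D (fun=> c).
Proof.
exists (mpolyC d c); last by move=> x _; rewrite mevalC.
by rewrite msizeC; case: eqP.
Qed.

(** Polynomials of degree at most [k] are determined on a set [D] by their
    values at finitely many points of [D], through a Lagrange-type formula. *)
Lemma poly_interpolation k (D : set 'rV[R]_d) :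
  exists r (x : 'I_r -> 'rV[R]_d) (L : 'I_r -> 'rV[R]_d -> R),
    [/\ forall j, D (x j), forall j, poly_on k setT (L j)
      & forall q, poly_on k setT q -> forall y, D y ->
          q y = \sum_j L j y * q (x j)].
Proof.
pose B : finType := bmultinom d k.+1.
have enumB : {on [pred m | true], bijective (@enum_val B B)}.
  exact/onW_bij/enum_val_bij.
(* [phi y] lists the values at [y] of all monomials of degree at most [k]. *)
pose phi (y : 'rV[R]_d) : 'rV[R]_#|B| := \row_i monomial (enum_val i : B) y.
have [r [A [DA AD]]] := finite_spanning_rows (phi @` D).
have /choice[x xP] : forall j, exists y, D y /\ phi y = row j A.
  by move=> j; have [y Dy yA] := DA j; exists y.
exists r, x, (fun j y => (phi y *m pinvmx A) 0 j); split.
- by move=> j; case: (xP j).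
- move=> j; pose c (m : B) := pinvmx A (enum_rank m) j.
  rewrite (_ : (fun _ => _) = fun y => \sum_m c m * monomial m y).
    exact: monomials_poly_on.
  apply/funext => y; rewrite mxE (reindex _ enumB)/=; apply: eq_bigr => i _.
  by rewrite mxE /c enum_valK mulrC.
- move=> q /poly_on_monomials[c qc] y Dy.
  have qE v : q v = (phi v *m \col_i c (enum_val i)) 0 0.
    rewrite qc mxE (reindex _ enumB)/=; apply: eq_bigr => i _.
    by rewrite !mxE mulrC.
  have phiE : phi y = \sum_j (phi y *m pinvmx A) 0 j *: row j A.
    by rewrite -mulmx_sum_row mulmxKpV//; apply: AD; exists y.
  rewrite qE {1}phiE mulmx_suml summxE.
  apply: eq_bigr => j _; rewrite -scalemxAl mxE; congr (_ * _).
  by rewrite qE; case: (xP j) => _ ->.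
Qed.

End Polynomials.

(** * Integration and time differentiation of polynomials *)

Section IntegrablePolynomials.
Context (R : realType) (d : nat).
Implicit Types (q : 'rV[R]_d -> R).

Lemma measurable_monomial (m : 'I_d -> nat) :
  measurable_fun setT (@monomial R d m).
Proof.
apply: measurable_prod => i _; apply: measurable_funX.
exact: measurable_coord.
Qed.

Lemma monomial_cube_le (m : 'I_d -> nat) (M : R) x : row_cube d M x ->
  `|monomial m x| <= \prod_i M ^+ m i.
Proof.
move=> Mx; rewrite /monomial normr_prod; apply: ler_prod => i _.
rewrite normr_ge0 normrX /= lerXn2r ?nnegrE//.
- apply: (@le_trans _ _ `|x 0 i|) => //.
  by have := Mx i; rewrite in_itv/= -ler_norml.
- by have := Mx i; rewrite in_itv/= -ler_norml.
Qed.

Lemma integrable_poly k q (A : set 'rV[R]_d) (M : R) :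
  poly_on k setT q -> measurable A -> A `<=` row_cube d M ->
  (lebesgue_row R d).-integrable A (EFin \o q).
Proof.
move=> /poly_on_monomials[c qc] mA AM.
have -> : q = fun x => \sum_m c m * monomial m x by exact/funext.
apply: measurable_bounded_integrable => //.
- apply: le_lt_trans (lebesgue_row_cube_lty d M).
  by apply: le_measure; rewrite ?inE//; exact: measurable_row_cube.
- apply: (measurable_funS measurableT) => //; apply: measurable_sum => m.
  by apply: measurable_funM => //; exact: measurable_monomial.
- exists (\sum_m `|c m| * \prod_i M ^+ m i); split; first exact: num_real.
  move=> C /ltW MC x /= /AM Mx; apply: le_trans MC.
  apply: le_trans (ler_norm_sum _ _ _) _; apply: ler_sum => m _.
  by rewrite normrM ler_wpM2l// monomial_cube_le.
Qed.

End IntegrablePolynomials.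

(** Every time of (0, tN] is an accumulation point of (0, tN] from the left. *)
Lemma time_filter_proper (R : realType) (tN t : R) : time_interval tN t ->
  ProperFilter (within (time_interval tN) t^').
Proof.
rewrite /time_interval /= in_itv/= => /andP[t0 tt].
split; last exact: within_filter.
move=> n0; apply: (@filter_not_empty _ (at_left t)).
have n1 : nbhs t [set s | s != t -> `]0, tN]%classic s -> False] by exact: n0.
have n2 : \forall s \near nbhs t, 0 < s by exact: lt_nbhsr.
suff : nbhs t [set s | s < t -> False] by [].
apply: filterS2 n1 n2 => s h s0 /= st; apply: h.
  by rewrite lt_eqF.
by rewrite /= in_itv/= s0/= (le_trans (ltW st)).
Qed.

Section Differentiation.
Context (R : realType) (d : nat) (V : finType) (z : V -> 'rV[R]_d).
Context (tN : R) (k : nat) (K : {set V}).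
Implicit Types (v : 'rV[R]_d -> 'rV[R]_d).

Lemma integrable_poly_cell (q : 'rV[R]_d -> R) : poly_on k setT q ->
  (lebesgue_row R d).-integrable (cell z K) (EFin \o q).
Proof.
move=> qk; have [M KM] := hull_sub_cube z K.
apply: (@integrable_poly _ _ k q _ M) => //; first exact: measurable_cell.
by apply: subset_trans KM; exact: interior_subset.
Qed.

(** Differentiation under the integral sign for polynomials of bounded degree
    on a simplex: by interpolation, the value at each point and the integral are
    linear combinations, with coefficients independent of time, of the values at
    finitely many points. *)
Lemma is_time_derive_vintegral (w : R -> 'rV[R]_d -> 'rV[R]_d) (t : R) :
  time_interval tN t ->
  (forall s, time_interval tN s ->
    forall i, poly_on k setT (fun x => w s x 0 i)) ->
  (forall x, hull z K x -> time_derivable (time_interval tN) (w^~ x) t) ->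
  is_time_derive (time_interval tN)
    (fun s => vintegral (lebesgue_row R d) (cell z K) (w s)) t
    (vintegral (lebesgue_row R d) (cell z K)
      (fun x => time_derive (time_interval tN) (w^~ x) t)).
Proof.
move=> It wk wt; have PF := time_filter_proper It.
have [r [x [L [Kx Lk Lq]]]] := poly_interpolation k (hull z K).
set I := time_interval tN in It wk wt PF *.
pose l y := time_derive I (w^~ y) t.
have wl y : hull z K y ->
    time_quotient (w^~ y) t s @[s --> within I t^'] --> l y.
  by move=> /wt.
have wE s y : I s -> hull z K y -> w s y = \sum_j L j y *: w s (x j).
  move=> Is Ky; apply/rowP => i; rewrite (Lq _ (wk s Is i) y Ky) summxE.
  by apply: eq_bigr => j _; rewrite mxE.
have lE y : hull z K y -> l y = \sum_j L j y *: l (x j).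
  move=> Ky; apply: (@cvg_unique _ _ _ _ _ _ (wl y Ky)) => //.
  have : \sum_j L j y *: time_quotient (w^~ (x j)) t s @[s --> within I t^'] -->
      \sum_j L j y *: l (x j).
    by apply: cvg_sum_normed => j _; apply: cvgZl_tmp; exact: wl.
  apply: cvg_trans; apply: near_eq_cvg.
  rewrite near_withinE; apply: nearW => s Is.
  rewrite /time_quotient !wE// -sumrB scaler_sumr; apply: eq_bigr => j _.
  by rewrite -scalerBr !scalerA mulrC.
pose c j := \int[lebesgue_row R d]_(y in cell z K) L j y.
(* A function obeying the interpolation formula on [hull z K] has as integral
   a combination of its values at the nodes, with weights [c j]. *)
have intE (g : 'rV[R]_d -> 'rV[R]_d) :
    (forall y, hull z K y -> g y = \sum_j L j y *: g (x j)) ->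
    vintegral (lebesgue_row R d) (cell z K) g = \sum_j c j *: g (x j).
  move=> gE; apply/rowP => i; rewrite mxE summxE.
  rewrite (@eq_Rintegral _ _ _ _ _
    (fun y => \sum_j L j y * g (x j) 0 i)); last first.
    move=> y /set_mem/interior_subset Ky; rewrite gE// summxE.
    by apply: eq_bigr => j _; rewrite mxE.
  rewrite Rintegral_sum; last 2 first.
  - exact: measurable_cell.
  - move=> j _.
    rewrite (_ : _ \o _ = fun y => (EFin (L j y) * (g (x j) 0 i)%:E)%E)//.
    apply: integrableZr; first exact: measurable_cell.
    exact: integrable_poly_cell.
  apply: eq_bigr => j _.
  rewrite RintegralZr ?mxE//; first exact: measurable_cell.
  exact: integrable_poly_cell.
rewrite intE//.
have : \sum_j c j *: time_quotient (w^~ (x j)) t s @[s --> within I t^'] -->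
    \sum_j c j *: l (x j).
  by apply: cvg_sum_normed => j _; apply: cvgZl_tmp; exact: wl.
apply: cvg_trans; apply: near_eq_cvg.
rewrite near_withinE; apply: nearW => s Is.
rewrite /time_quotient !intE; [|by move=> y; exact: wE..].
rewrite -sumrB scaler_sumr; apply: eq_bigr => j _.
by rewrite -scalerBr !scalerA mulrC.
Qed.

End Differentiation.

(** * Momentum balance *)

Section Vectors.
Context (R : realType) (d : nat).

Lemma dot_deltaZ (a : 'rV[R]_d) (c : R) i :
  dot a (c *: delta_mx 0 i) = c * a 0 i.
Proof.
rewrite /dot (bigD1 i)//= big1 ?addr0; first by rewrite !mxE !eqxx mulr1 mulrC.
by move=> j ji; rewrite !mxE (negPf ji) andbF !mulr0.
Qed.

Lemma ddot_outer_delta (A : 'M[R]_d) (b : 'rV[R]_d) i :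
  ddot A (outer (delta_mx 0 i) b) = tensor_apply A b 0 i.
Proof.
rewrite /ddot (bigD1 i)//= [X in _ + X]big1 ?addr0; last first.
  move=> j ji; apply: big1 => l _; by rewrite !mxE (negPf ji) andbF mul0r mulr0.
by rewrite !mxE; apply: eq_bigr => j _; rewrite !mxE !eqxx mul1r.
Qed.

Lemma outer0 (b : 'rV[R]_d) : outer 0 b = 0.
Proof. by apply/matrixP => i j; rewrite !mxE mul0r. Qed.

Lemma ddot0 (A : 'M[R]_d) : ddot A 0 = 0.
Proof. by apply: big1 => i _; apply: big1 => j _; rewrite mxE mulr0. Qed.

Lemma vgradient_cst (a x : 'rV[R]_d) : vgradient (fun=> a) x = 0.
Proof. by apply/matrixP => i j; rewrite !mxE derive_cst. Qed.

End Vectors.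

Section Mesh.
Context (R : realType) (d : nat) (V : finType) (z : V -> 'rV[R]_d).
Context (Omega : set 'rV[R]_d) (T : {set {set V}}).
Context (hT : triangulation z Omega T).
Local Notation mu := (lebesgue_row R d).

Lemma eq_cell_boundary_integral K (g g' : {set V} -> 'rV[R]_d -> R) :
  (forall F x, g F x = g' F x) ->
  cell_boundary_integral z K g = cell_boundary_integral z K g'.
Proof.
move=> gg'; congr (cell_boundary_integral z K _).
by apply/funext => F; apply/funext.
Qed.

Lemma cell_boundary_integral0 K :
  cell_boundary_integral z K (fun _ _ => 0 : R) = 0.
Proof. by apply: big1 => F _; rewrite /Rintegral integral0. Qed.

Lemma broken_fun_single K (g : 'rV[R]_d -> 'rV[R]_d) x : K \in T ->
  broken_fun z T (fun K' y => if K' == K then g y else 0) x =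
  \1_(cell z K) x *: g x.
Proof.
move=> KT; rewrite /broken_fun (bigD1 K)//= eqxx big1 ?addr0//.
by move=> K' /andP[_ /negPf ->]; rewrite scaler0.
Qed.

(** On a cell no other cell contributes to a broken function. *)
Lemma broken_fun_cell (v : {set V} -> 'rV[R]_d -> 'rV[R]_d) K x : K \in T ->
  cell z K x -> broken_fun z T v x = v K x.
Proof.
move=> KT Kx; rewrite /broken_fun (bigD1 K)//= indicE mem_set// scale1r.
rewrite big1 ?addr0// => K' /andP[K'T K'K].
rewrite indicE memNset ?scale0r// => K'x; move/eqP : K'K; apply.
exact: (cell_disjoint hT K'T KT K'x Kx).
Qed.

Lemma Rintegral_indic_cell K (g : 'rV[R]_d -> R) : K \in T ->
  \int[mu]_(x in Omega) (\1_(cell z K) x * g x) = \int[mu]_(x in cell z K) g x.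
Proof.
move=> KT; rewrite indicM_patch -Rintegral_mkcondr; congr (Rintegral mu _ _).
by apply: setIidr; exact: (cell_sub_domain hT).
Qed.

Lemma Rintegral_cells (g : {set V} -> 'rV[R]_d -> R) :
  (forall K, K \in T -> mu.-integrable (cell z K) (EFin \o g K)) ->
  \int[mu]_(x in Omega) (\sum_(K in T) \1_(cell z K) x * g K x) =
  \sum_(K in T) \int[mu]_(x in cell z K) g K x.
Proof.
move=> ig; rewrite Rintegral_sum.
- by apply: eq_bigr => K KT; exact: Rintegral_indic_cell.
- exact: measurable_domain hT.
- move=> K KT; rewrite indicM_patch -restrict_EFin.
  apply/integrable_restrict.
  + by [exact: measurable_cell|exact: measurable_domain hT].
  + by [exact: measurable_cell|exact: measurable_domain hT].
  rewrite setIidr; first exact: ig.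
  exact: (cell_sub_domain hT).
Qed.

Lemma vintegral_broken_fun k (v : {set V} -> 'rV[R]_d -> 'rV[R]_d) :
  in_V T k v ->
  vintegral mu Omega (broken_fun z T v) =
  \sum_(K in T) vintegral mu (cell z K) (v K).
Proof.
move=> vk; apply/rowP => i; rewrite mxE summxE.
rewrite (@eq_Rintegral _ _ _ _ _
  (fun x => \sum_(K in T) \1_(cell z K) x * v K x 0 i)).
  rewrite Rintegral_cells; first by apply: eq_bigr => K _; rewrite mxE.
  by move=> K KT; exact: (integrable_poly_cell z K (vk K KT i)).
by move=> x _; rewrite /broken_fun summxE; apply: eq_bigr => K _; rewrite mxE.
Qed.

(** The domain is bounded, so that square-integrable functions are integrable:
    multiply by the indicator function of the domain. *)
Lemma L2_integrable_domain (g : 'rV[R]_d -> 'rV[R]_d) i : L2 mu Omega g ->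
  mu.-integrable Omega (EFin \o (fun x => g x 0 i)).
Proof.
move=> g2; have mO := measurable_domain hT.
have O2 : (\1_Omega : _ -> R) \in Lfun mu 2%:E.
  rewrite inE; apply/andP; split; rewrite inE/=; first exact: measurable_indic.
  rewrite /finite_norm unlock /=; apply: poweR_lty.
  rewrite (@eq_integral _ _ _ mu setT (fun x => (\1_Omega x)%:E)); last first.
    move=> x _; rewrite ger0_norm// indicE; case: (x \in Omega).
      by rewrite powR1.
    by rewrite powR0// pnatr_eq0.
  by rewrite integral_indic// setIT; exact: (lebesgue_domain_lty hT).
have := Lfun2_mul_Lfun1 (g2 i) O2.
move=> /Lfun1_integrable.
rewrite (_ : _ \o _ = (EFin \o (fun x => g x 0 i)) \_ Omega).
  by move=> /(integrable_mkcond _ mO).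
rewrite restrict_EFin; congr (_ \o _); apply/funext => x /=.
by rewrite !patchE indicE; case: ifP; rewrite ?mulr1 ?mulr0.
Qed.

Lemma vintegral_domain (g : 'rV[R]_d -> 'rV[R]_d) : L2 mu Omega g ->
  vintegral mu Omega g = \sum_(K in T) vintegral mu (cell z K) g.
Proof.
move=> g2; apply/rowP => i; rewrite mxE summxE.
have ig := L2_integrable_domain i g2; have mO := measurable_domain hT.
have igK K : K \in T -> mu.-integrable (cell z K) (EFin \o (fun x => g x 0 i)).
  move=> KT; apply: integrableS ig => //; first exact: measurable_cell.
  exact: (cell_sub_domain hT).
transitivity (\int[mu]_(x in Omega)
    (\sum_(K in T) \1_(cell z K) x * g x 0 i)); last first.
  by rewrite Rintegral_cells//; apply: eq_bigr => K _; rewrite mxE.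
congr fine; apply: ae_eq_integral => //.
- exact: measurable_int ig.
- apply/measurable_EFinP; under eq_fun do rewrite -big_enum.
  apply: measurable_sum => K.
  apply: measurable_funM; last first.
    by apply/measurable_EFinP; exact: measurable_int ig.
  by apply: measurable_indic; exact: measurable_cell.
have := negligible_skeleton hT; apply: negligibleS => x /= /not_implyP[Ox nx].
split=> // K KT Kx; apply: nx; congr EFin.
have /rowP/(_ i) gx := broken_fun_cell (fun=> g) KT Kx.
by rewrite -[LHS]gx /broken_fun summxE; apply: eq_bigr => K' _; rewrite mxE.
Qed.

Section Balance.
Context (GammaN : set 'rV[R]_d) (k : nat) (nu alpha : R).
Context (f h : 'rV[R]_d -> 'rV[R]_d).
Context (u dtu ubar : {set V} -> 'rV[R]_d -> 'rV[R]_d)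
  (p pbar : {set V} -> 'rV[R]_d -> R).

(** The cell momentum equation tested with the unit vectors on [K], extended by
    zero. *)
Lemma cell_balance K : K \in T ->
  cell_momentum z Omega T k nu alpha f u dtu ubar p pbar ->
  vintegral mu (cell z K) (dtu K) = vintegral mu (cell z K) f
    - \row_i cell_boundary_integral z K (fun F x =>
        tensor_apply (sigma_hat z nu alpha u ubar pbar K F x)
                     (outward_normal z K F) 0 i).
Proof.
move=> KT cm; apply/rowP => i; rewrite !mxE.
pose v (K' : {set V}) (_ : 'rV[R]_d) : 'rV[R]_d :=
  if K' == K then delta_mx 0 i else 0.
have /cm : in_V T k v by move=> K' _ j; exact: poly_on_cst.
have vx x : broken_fun z T v x = \1_(cell z K) x *: delta_mx 0 i.
  exact: (broken_fun_single (fun=> delta_mx 0 i) x KT).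
have -> : \int[mu]_(x in Omega) dot (f x) (broken_fun z T v x) =
    \int[mu]_(x in cell z K) f x 0 i.
  rewrite -(Rintegral_indic_cell _ KT); apply: eq_Rintegral => x _.
  by rewrite vx dot_deltaZ.
have -> : \int[mu]_(x in Omega)
      dot (broken_fun z T dtu x) (broken_fun z T v x) =
    \int[mu]_(x in cell z K) dtu K x 0 i.
  rewrite -(Rintegral_indic_cell _ KT); apply: eq_Rintegral => x _.
  rewrite vx dot_deltaZ indicE; have [/set_mem Kx|] := boolP (x \in _).
    by rewrite (broken_fun_cell _ KT Kx).
  by rewrite !mul0r.
rewrite [X in _ - X]big1; last first.
  move=> K' _; under eq_Rintegral do rewrite vgradient_cst ddot0.
  by rewrite /Rintegral integral0.
rewrite [X in _ + X]big1; last first.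
  move=> K' _; rewrite -[RHS](cell_boundary_integral0 K').
  by apply: eq_cell_boundary_integral => F x; rewrite vgradient_cst ddot0.
rewrite (bigD1 K)//= [X in _ + (_ + X)]big1; last first.
  move=> K' /andP[_ K'K]; rewrite -[RHS](cell_boundary_integral0 K').
  apply: eq_cell_boundary_integral => F x.
  by rewrite /v (negPf K'K) outer0 ddot0.
rewrite subr0 !addr0 => ->.
rewrite (_ : cell_boundary_integral z K _ =
   cell_boundary_integral z K (fun F x =>
     tensor_apply (sigma_hat z nu alpha u ubar pbar K F x)
     (outward_normal z K F) 0 i)) ?addrK//.
by apply: eq_cell_boundary_integral => F x; rewrite /v eqxx ddot_outer_delta.
Qed.

(** The facet momentum equation tested with the unit vectors on all facets,
    which belong to the facet space because the Dirichlet boundary is empty. *)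
Lemma facet_balance :
  facet_momentum z Omega set0 GammaN T k nu alpha h u ubar pbar ->
  \sum_(K in T) (\row_i cell_boundary_integral z K (fun F x =>
      tensor_apply (sigma_hat z nu alpha u ubar pbar K F x)
                   (outward_normal z K F) 0 i)) =
  (\row_i boundary_integral z Omega T GammaN (fun K F x =>
     (1 - upwind z u K F x) * dot (ubar F x) (outward_normal z K F)
       * ubar F x 0 i))
  + \row_i boundary_integral z Omega T GammaN (fun K F x => h x 0 i).
Proof.
move=> fm; apply/rowP => i; rewrite !mxE summxE.
pose vbar (_ : {set V}) (_ : 'rV[R]_d) : 'rV[R]_d := delta_mx 0 i.
have /fm : in_Vbar z T k set0 vbar.
  move=> F _; split; first by move=> j; exact: poly_on_cst.
  by apply: aeW => x [].
have dotv (a : 'rV[R]_d) : dot a (delta_mx 0 i) = a 0 i.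
  by rewrite -[delta_mx _ _]scale1r dot_deltaZ mul1r.
rewrite /vbar.
have -> : (fun (K F : {set V}) x => dot (h x) (delta_mx 0 i)) =
    (fun K F x => h x 0 i).
  by do 3 apply/funext => ?; rewrite dotv.
have -> : (fun (K F : {set V}) x => (1 - upwind z u K F x) *
      dot (ubar F x) (outward_normal z K F) * dot (ubar F x) (delta_mx 0 i)) =
    (fun K F x => (1 - upwind z u K F x) *
      dot (ubar F x) (outward_normal z K F) * ubar F x 0 i).
  by do 3 apply/funext => ?; rewrite dotv.
move=> ->; rewrite addrC subrK; apply: eq_bigr => K _; rewrite mxE.
by apply: eq_cell_boundary_integral => F x; rewrite ddot_outer_delta.
Qed.

End Balance.

End Mesh.

Theorem proposition2
  (R : realType) (d : nat) (hd : d = 2%N \/ d = 3%N)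
  (V : finType) (z : V -> 'rV[R]_d) (T : {set {set V}})
  (Omega : set 'rV[R]_d) (hT : triangulation z Omega T)
  (GammaD GammaN : set 'rV[R]_d)
  (mGammaD : measurable GammaD) (mGammaN : measurable GammaN)
  (hGammaU : GammaD `|` GammaN = frontier Omega)
  (hGammaI : GammaD `&` GammaN = set0)
  (k : nat) (hk : (2 <= k)%N)
  (nu alpha : R) (nu_gt0 : 0 < nu) (alpha_gt0 : 0 < alpha)
  (tN : R) (tN_gt0 : 0 < tN)
  (f h : R -> 'rV[R]_d -> 'rV[R]_d)
  (hf : forall t, time_interval tN t -> L2 (lebesgue_row R d) Omega (f t))
  (hh : forall t, time_interval tN t -> forall F, F \in facets d T ->
    boundary_facet z Omega F -> L2 (facet_measure z F) GammaN (h t))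
  (u ubar : R -> {set V} -> 'rV[R]_d -> 'rV[R]_d)
  (p pbar : R -> {set V} -> 'rV[R]_d -> R)
  (hu : forall t, time_interval tN t -> forall K x, K \in T -> hull z K x ->
    time_derivable (time_interval tN) (fun s => u s K x) t)
  (hsol : forall t, time_interval tN t ->
    semi_discrete_problem z Omega GammaD GammaN T k nu alpha (f t) (h t)
      (u t) (fun K x => time_derive (time_interval tN) (fun s => u s K x) t)
      (ubar t) (p t) (pbar t)) :
  (forall t, time_interval tN t -> forall K, K \in T ->
    is_time_derive (time_interval tN)
      (fun s => vintegral (lebesgue_row R d) (cell z K) (u s K)) t
      (vintegral (lebesgue_row R d) (cell z K) (f t)
       - \row_i cell_boundary_integral z K (fun F x =>
           tensor_apply (sigma_hat z nu alpha (u t) (ubar t) (pbar t) K F x)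
                        (outward_normal z K F) 0 i)))
  /\
  (GammaD = set0 -> forall t, time_interval tN t ->
    is_time_derive (time_interval tN)
      (fun s => vintegral (lebesgue_row R d) Omega (broken_fun z T (u s))) t
      (vintegral (lebesgue_row R d) Omega (f t)
       - \row_i boundary_integral z Omega T (frontier Omega) (fun K F x =>
           (1 - upwind z (u t) K F x) * dot (ubar t F x) (outward_normal z K F)
           * ubar t F x 0 i)
       - \row_i boundary_integral z Omega T (frontier Omega) (fun K F x =>
           h t x 0 i))).
Proof.
have uV s : time_interval tN s -> in_V T k (u s) by move=> /hsol[[]].
have cells t : time_interval tN t -> forall K, K \in T ->
    is_time_derive (time_interval tN)
      (fun s => vintegral (lebesgue_row R d) (cell z K) (u s K)) t
      (vintegral (lebesgue_row R d) (cell z K) (f t)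
       - \row_i cell_boundary_integral z K (fun F x =>
           tensor_apply (sigma_hat z nu alpha (u t) (ubar t) (pbar t) K F x)
                        (outward_normal z K F) 0 i)).
  move=> It K KT; have [_ _ _ cm _] := hsol t It.
  rewrite -(cell_balance hT KT cm).
  apply: (@is_time_derive_vintegral _ _ _ _ _ k) => //.
    by move=> s Is; exact: (uV s Is K KT).
  by move=> x; exact: hu.
split=> // GD0 t It; have [_ _ _ _ fm] := hsol t It.
have GN : GammaN = frontier Omega by rewrite -hGammaU GD0 set0U.
rewrite GD0 in fm; have PF := time_filter_proper It.
rewrite -addrA -opprD -GN -(facet_balance fm).
rewrite (vintegral_domain hT (hf t It)) -sumrB.
have : \sum_(K in T) time_quotient (fun s => vintegral (lebesgue_row R d)
      (cell z K) (u s K)) t s @[s --> within (time_interval tN) t^'] -->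
    \sum_(K in T) (vintegral (lebesgue_row R d) (cell z K) (f t)
       - \row_i cell_boundary_integral z K (fun F x =>
           tensor_apply (sigma_hat z nu alpha (u t) (ubar t) (pbar t) K F x)
                        (outward_normal z K F) 0 i)).
  by apply: cvg_sum_normed => K KT; exact: cells.
apply: cvg_trans; apply: near_eq_cvg.
rewrite near_withinE; apply: nearW => s Is.
rewrite /time_quotient (vintegral_broken_fun hT (uV s Is)).
by rewrite (vintegral_broken_fun hT (uV t It)) -sumrB scaler_sumr.
Qed.
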